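(* Let $K\subset\mathbb{R}^n$ be a nonempty closed convex set and let $f:\mathbb{R}^n\to\mathbb{R}$ be a polynomial of degree $d\geq 2$. If $\mathrm{OP}(K,f)$ is regular, then the following statements hold: (a) the solution map $\mathrm{Sol}_K(\cdot):\mathbb{R}_d[x]\rightrightarrows\mathbb{R}^n$, $g\mapsto\mathrm{Sol}(K,g)$, is locally bounded at $f$, i.e., there exists $\varepsilon>0$ such that the set $$O_\varepsilon:=\bigcup_{g\in\mathcal{B}(\varepsilon,d)}\mathrm{Sol}(K,f+g)$$ is bounded, where $\mathcal{B}(\varepsilon,d)$ is the open ball in $\mathbb{R}_d[x]$ with center $0$ and radius $\varepsilon$; (b) the solution map $\mathrm{Sol}_K(\cdot)$ is upper semicontinuous at $f$.
   Context: $\mathrm{OP}(K,f)$ denotes the problem of minimizing $f(x)$ subject to $x\in K$, and $\mathrm{Sol}(K,f)$ denotes its set of (global) minimizers; $\mathrm{Sol}(S,g)$ has the same meaning for any closed set $S$ and polynomial $g$. The asymptotic cone of a nonempty closed set $S\subset\mathbb{R}^n$ is $S_\infty=\{v\in\mathbb{R}^n:\exists t_k\to+\infty,\ \exists x_k\in S \text{ with } \lim_{k\to\infty} x_k/t_k=v\}$. $f_d$ denotes the homogeneous component of degree $d$ of $f$, where $d=\deg f$. The problem $\mathrm{OP}(K,f)$ is called regular if $\mathrm{Sol}(K_\infty,f_d)$ is bounded (the empty set counts as bounded). $\mathbb{R}_d[x]$ is the finite-dimensional space of all real polynomials in $n$ variables of degree at most $d$, with norm $\|g\|$ equal to the $\ell_2$-norm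 of the coefficient vector of $g$ in the monomial basis. A set-valued map $\Psi$ is upper semicontinuous at $\bar u$ if for any open set $V\subset\mathbb{R}^n$ with $\Psi(\bar u)\subset V$ there exists a neighborhood $U$ of $\bar u$ such that $\Psi(u)\subset V$ for all $u\in U$. *)

(* Defs.v *)
From HB Require Import structures.
From mathcomp Require Import all_boot all_order all_algebra.
From mathcomp Require Import all_classical all_reals all_analysis.
From mathcomp Require mpoly.
(* The notations of mpoly clash with those of mathcomp-analysis. *)
Export -(notations) mpoly.

Set Implicit Arguments.
Unset Strict Implicit.
Unset Printing Implicit Defensive.

Import Order.TTheory GRing.Theory Num.Theory.
Import numFieldNormedType.Exports.

Local Open Scope classical_set_scope.
Local Open Scope ring_scope.

(* R^n is 'rV[R]_n; its norm is the sup norm, which has the same open sets,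
   convergent sequences and bounded sets as the Euclidean norm. *)
Definition peval (R : realType) (n : nat) (f : mpoly n R) (x : 'rV[R]_n) : R :=
  meval (fun i => x ord0 i) f.

(* mmeasure mdeg f is 1 + deg f, and 0 for f = 0: the zero polynomial gets
   degree 0 here, so that it belongs to R_d[x] = polys_le d for every d. *)
Definition pdeg (R : realType) (n : nat) (f : mpoly n R) : nat :=
  (mmeasure mdeg f).-1.

Definition hcomp (R : realType) (n d : nat) (f : mpoly n R) : mpoly n R :=
  pihomog mdeg d f.

Definition Sol (R : realType) (n : nat) (S : set 'rV[R]_n) (g : mpoly n R) :
    set 'rV[R]_n :=
  [set x | S x /\ forall y, S y -> peval g x <= peval g y].

Definition asymptotic_cone (R : realType) (n : nat) (S : set 'rV[R]_n) :
    set 'rV[R]_n :=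
  [set v | exists (t : nat -> R) (x : nat -> 'rV[R]_n),
     [/\ t k @[k --> \oo] --> +oo,
         forall k, S (x k) &
         (t k)^-1 *: x k @[k --> \oo] --> v]].

Definition regular (R : realType) (n : nat) (K : set 'rV[R]_n)
    (f : mpoly n R) : Prop :=
  bounded_set (Sol (asymptotic_cone K) (hcomp (pdeg f) f)).

Definition polys_le (R : realType) (n d : nat) : set (mpoly n R) :=
  [set g | (pdeg g <= d)%N].

Definition coef_norm (R : realType) (n : nat) (g : mpoly n R) : R :=
  Num.sqrt (\sum_(m <- msupp g) mcoeff m g ^+ 2).

Definition poly_ball (R : realType) (n d : nat) (f : mpoly n R) (e : R) :
    set (mpoly n R) :=
  [set g : mpoly n R | polys_le d g /\ coef_norm (g - f) < e].

(* A neighborhood here is relative to R_d[x]: it need not be one among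
   polynomials of higher degree. *)
Definition poly_nbhs (R : realType) (n d : nat) (f : mpoly n R) :
    set (set (mpoly n R)) :=
  [set U | U `<=` polys_le d /\
           exists2 e : R, 0 < e & poly_ball d f e `<=` U].

Definition upper_semicontinuous_at (R : realType) (n d : nat)
    (Psi : mpoly n R -> set 'rV[R]_n) (f : mpoly n R) : Prop :=
  forall V : set 'rV[R]_n, open V -> Psi f `<=` V ->
    exists2 U, poly_nbhs d f U & forall g, U g -> Psi g `<=` V.

(* Main.v *)
Require Import Defs.
From HB Require Import structures.
From mathcomp Require Import all_boot all_order all_algebra.
From mathcomp Require Import all_classical all_reals all_analysis.

(** The proof is by contradiction and compactness, along sequences.

    Write d for the degree of f, f_d for its leading form and C for the
    asymptotic cone of K.  Everything rests on one limit
    ([cvg_peval_leading]): if p_k is of degree at most d and tends to q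
    coefficientwise, if s_k tends to 0 and s_k x_k tends to v, then
    s_k^d p_k(x_k) tends to q_d(v), because a monomial of degree j < d retains
    a factor s_k^(d - j).

    Suppose that local boundedness fails.  Then there are polynomials p_k
    tending to f and minimizers x_k of p_k on K with |x_k| tending to infinity.
    Two things follow.  Since p_k is bounded below on K, comparing its minimum
    with its values along a sequence of K that goes to infinity in a
    direction w of C gives (p_k)_d(w) >= 0 ([Sol_hcomp_ge0]), hence
    f_d(w) >= 0 in the limit: f_d is nonnegative on C.  On the other hand
    x_k/|x_k| has a limit point v, a unit vector of C; comparing p_k(x_k) with
    the value of p_k at a fixed point of K and dividing by |x_k|^d gives
    f_d(v) <= 0.  As f_d is homogeneous, it vanishes on the whole ray spanned
    by v, which therefore consists of minimizers of f_d on C; so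
    Sol(C, f_d) is unbounded, against regularity
    ([unbounded_minimizers_not_regular]).

    Upper semicontinuity follows from local boundedness: if it failed at an
    open set V containing Sol(K, f), there would be minimizers x_k outside V of
    polynomials tending to f; they are bounded, and a limit point of theirs
    would be a minimizer of f on K outside V ([locally_bounded_Sol_usc]). *)

Import Order.TTheory GRing.Theory Num.Theory.
Import numFieldNormedType.Exports.

Local Open Scope classical_set_scope.
Local Open Scope ring_scope.

Set Implicit Arguments.
Unset Strict Implicit.

(** * Limits of values of polynomials *)

Section Peval.
Context {R : realType} {n : nat}.
Implicit Types (p q : mpoly n R) (x v : 'rV[R]_n) (m : multinom n).

Definition monval m x : R := mmap1 (fun i => x ord0 i) m.

(** The sum ranges over all the monomials of degree at most d, not over the
    support of p: the index set is then the same for every polynomial of a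
    sequence, and limits can be taken term by term. *)
Lemma peval_monvals d p x : polys_le d p ->
  peval p x = \sum_(m : bmultinom n d.+1) mcoeff m p * monval m x.
Proof.
move=> dp; rewrite /peval /meval (mmapE d.+1) //.
by move: dp; rewrite /polys_le /pdeg /=; case: mmeasure.
Qed.

Lemma peval_hcomp_monvals d p x : polys_le d p ->
  peval (hcomp d p) x =
  \sum_(m : bmultinom n d.+1 | mdeg m == d) mcoeff m p * monval m x.
Proof.
move=> dp; rewrite /peval /hcomp (pihomogwE _ _ (k := d.+1)); last first.
  by move: dp; rewrite /polys_le /pdeg /=; case: mmeasure.
rewrite raddf_sum/=; apply: eq_bigr => m _.
by rewrite mevalZ mevalX.
Qed.

Lemma monvalZ m (s : R) x : monval m (s *: x) = s ^+ mdeg m * monval m x.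
Proof.
rewrite /monval /mmap1 mdegE -prodrXr -big_split/=.
by apply: eq_bigr => i _; rewrite mxE exprMn.
Qed.

Lemma cvg_monval m (x : nat -> 'rV[R]_n) v :
  x k @[k --> \oo] --> v -> monval m (x k) @[k --> \oo] --> monval m v.
Proof.
move=> xv; rewrite /monval /mmap1.
apply: cvg_big => [u|i _]; first exact: mul_continuous.
apply: (continuous_cvg _ (@exprn_continuous R (m i) _)).
exact: (continuous_cvg _ (@coord_continuous R 1 n ord0 i v)).
Qed.

(* Coefficientwise convergence replaces convergence for the norm: it is what
   the term by term limits consume, and it passes to subsequences and to
   leading forms at once. *)
Section Limits.
Variables (d : nat) (p : nat -> mpoly n R) (q : mpoly n R).
Hypothesis dp : forall k, polys_le d (p k).
Hypothesis dq : polys_le d q.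
Hypothesis pq : forall m, mcoeff m (p k) @[k --> \oo] --> mcoeff m q.

Lemma cvg_peval (x : nat -> 'rV[R]_n) v :
  x k @[k --> \oo] --> v -> peval (p k) (x k) @[k --> \oo] --> peval q v.
Proof.
move=> xv; rewrite (peval_monvals _ dq).
under eq_cvg do rewrite (peval_monvals _ (dp _)).
apply: cvg_big => [u|i _]; first exact: add_continuous.
by apply: cvgM; [exact: pq|exact: cvg_monval].
Qed.

Lemma cvg_peval_hcomp v :
  peval (hcomp d (p k)) v @[k --> \oo] --> peval (hcomp d q) v.
Proof.
rewrite (peval_hcomp_monvals _ dq).
under eq_cvg do rewrite (peval_hcomp_monvals _ (dp _)).
apply: cvg_big => [u|i _]; first exact: add_continuous.
by apply: cvgM; [exact: pq|exact: cvg_cst].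
Qed.

(** With s = 1/t this is the asymptotic behaviour of p_k at infinity: the
    lower degree terms are negligible in front of t^d.  In terms of s the
    rescaling is an identity between monomials, with no division in it. *)
Lemma cvg_peval_leading (s : nat -> R) (x : nat -> 'rV[R]_n) v :
  s k @[k --> \oo] --> 0 -> s k *: x k @[k --> \oo] --> v ->
  s k ^+ d * peval (p k) (x k) @[k --> \oo] --> peval (hcomp d q) v.
Proof.
move=> s0 sxv; rewrite (peval_hcomp_monvals _ dq).
under eq_cvg do rewrite (peval_monvals _ (dp _)) mulr_sumr.
rewrite big_mkcond/=.
apply: cvg_big => [u|i _]; first exact: add_continuous.
have id : (mdeg i <= d)%N by rewrite -ltnS; exact: bmdeg.
(* The powers of s that the monomial does not absorb stay in front. *)
have E k : s k ^+ d * (mcoeff i (p k) * monval i (x k)) =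
    s k ^+ (d - mdeg i) * (mcoeff i (p k) * monval i (s k *: x k)).
  by rewrite monvalZ -{1}(subnK id) exprD -!mulrA;
    congr (_ * _); rewrite mulrCA.
under eq_cvg do rewrite E.
have -> : (if mdeg i == d then mcoeff i q * monval i v else 0) =
    0 ^+ (d - mdeg i) * (mcoeff i q * monval i v).
  rewrite expr0n subn_eq0; have [->|ne] := eqVneq (mdeg i) d.
    by rewrite leqnn mul1r.
  by rewrite leqNgt ltn_neqAle ne id mul0r.
apply: cvgM; last by apply: cvgM; [exact: pq|exact: cvg_monval].
exact: (continuous_cvg _ (@exprn_continuous R _ 0)).
Qed.

End Limits.

End Peval.

(** * Limit points, degrees and the asymptotic cone *)

Lemma cvg_infty_ge (phi : nat -> nat) :
  (forall j, (j <= phi j)%N) -> phi j @[j --> \oo] --> \oo.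
Proof.
move=> jphi; apply/cvgnyPge => N; exists N => //= j Nj.
exact: leq_trans (jphi j).
Qed.

Section Rn.
Context {R : realType} {n : nat}.
Implicit Types (p q f g h : mpoly n R) (x v : 'rV[R]_n) (K : set 'rV[R]_n).

Lemma bounded_set_le (A : set 'rV[R]_n) (M : R) :
  (forall x, A x -> `|x| <= M) -> bounded_set A.
Proof.
move=> AM; exists M; split=> [|N MN x Ax]; first exact: num_real.
exact: le_trans (AM x Ax) (ltW MN).
Qed.

(** Bolzano-Weierstrass.  The extraction is only required to satisfy
    j <= phi j: this is enough for limits to pass to it, and it makes the
    choice of each phi j independent of the others. *)
Lemma bounded_seq_limit_point (x : nat -> 'rV[R]_n) (M : R) :
  (forall k, `|x k| <= M) ->
  exists (phi : nat -> nat) (v : 'rV[R]_n),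
    (forall j, (j <= phi j)%N) /\ x (phi j) @[j --> \oo] --> v.
Proof.
move=> xM.
have : compact (closed_ball_ Num.norm 0 M : set 'rV[R]_n).
  apply: bounded_closed_compact; last exact: closed_closed_ball_.
  by apply: (bounded_set_le (M := M)) => y;
    rewrite /closed_ball_ /= sub0r normrN.
move=> /(_ (x k @[k --> \oo]) _) [].
  by exists 0%N => //= k _; rewrite /closed_ball_ /= sub0r normrN.
move=> v [_ clv].
have /choice[phi phiP] : forall j : nat, exists k,
    (j <= k)%N /\ `|v - x k| < (j.+1%:R)^-1.
  move=> j; have j0 : 0 < j.+1%:R^-1 :> R by rewrite invr_gt0 ltr0n.
  have xj : (x k @[k --> \oo]) (x @` [set k | (j <= k)%N]).
    by exists j => //= k jk; exists k.
  have [_ [[k jk <-] vk]] := clv _ _ xj (nbhsx_ballx v _ j0).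
  by exists k; split => //; move: vk; rewrite -ball_normE.
exists phi, v; split=> [j|]; first by case: (phiP j).
apply/cvgrPdist_lt => e e0.
have := @cvg_harmonic R => /cvgr0Pnorm_lt /(_ e e0).
apply: filterS => j; rewrite /harmonic /= gtr0_norm ?invr_gt0 ?ltr0n //.
by apply: lt_trans; case: (phiP j).
Qed.

Lemma polys_leB d p q : polys_le d p -> polys_le d q -> polys_le d (p - q).
Proof.
rewrite /polys_le /pdeg /= -!subn1 !leq_subLR !add1n => dp dq.
by rewrite (leq_trans (mmeasureD_le _ _ _)) // geq_max dp mmeasureN.
Qed.

Lemma polys_leD d p q : polys_le d p -> polys_le d q -> polys_le d (p + q).
Proof.
rewrite /polys_le /pdeg /= -!subn1 !leq_subLR !add1n => dp dq.
by rewrite (leq_trans (mmeasureD_le _ _ _)) // geq_max dp.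
Qed.

Lemma mcoeff_le_coef_norm p (m : multinom n) : `|mcoeff m p| <= coef_norm p.
Proof.
have [mp|mp] := boolP (m \in msupp p); last first.
  by rewrite memN_msupp_eq0 // normr0 sqrtr_ge0.
rewrite -sqrtr_sqr ler_wsqrtr // (big_rem _ mp) /=.
by rewrite lerDl sumr_ge0 // => i _; exact: sqr_ge0.
Qed.

Lemma cvg_mcoeff_coef_norm (p : nat -> mpoly n R) q (e : nat -> R) :
  e k @[k --> \oo] --> 0 -> (forall k, coef_norm (p k - q) < e k) ->
  forall m : multinom n, mcoeff m (p k) @[k --> \oo] --> mcoeff m q.
Proof.
move=> e0 pqe m; apply/cvgrPdist_lt => r r0.
move/cvgr0Pnorm_lt : e0 => /(_ r r0).
apply: filterS => k ekr; rewrite distrC -mcoeffB.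
rewrite (le_lt_trans (mcoeff_le_coef_norm _ _)) // (lt_trans (pqe k)) //.
exact: le_lt_trans (ler_norm _) ekr.
Qed.

Lemma asymptotic_cone_scale K (s : R) v :
  0 < s -> asymptotic_cone K v -> asymptotic_cone K (s *: v).
Proof.
move=> s0 [t [x [ty Kx xv]]]; exists (fun k => s^-1 * t k), x; split=> //.
  move/cvgryPge : ty => ty; apply/cvgryPge => A.
  by apply: filterS (ty (s * A)) => k; rewrite ler_pdivlMl.
under eq_cvg do rewrite invfM invrK -scalerA.
by apply: cvgZ; [exact: cvg_cst|].
Qed.

Lemma peval_hcompZ d p (s : R) x : polys_le d p ->
  peval (hcomp d p) (s *: x) = s ^+ d * peval (hcomp d p) x.
Proof.
move=> dp; rewrite !(peval_hcomp_monvals _ dp) mulr_sumr.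
by apply: eq_bigr => m /eqP md; rewrite monvalZ md mulrCA.
Qed.

End Rn.
(** * Minimizers of nearby polynomials *)

Section Minimizers.
Context {R : realType} {n d : nat}.
Variables (K : set 'rV[R]_n) (d_gt0 : (0 < d)%N).
Implicit Types (f g h : mpoly n R) (v : 'rV[R]_n).

(** A minimizer z bounds h below on K by the constant h(z); divided by t_k^d
    along a sequence of K that represents v, this constant tends to 0. *)
Lemma Sol_hcomp_ge0 h v : polys_le d h -> Sol K h !=set0 ->
  asymptotic_cone K v -> 0 <= peval (hcomp d h) v.
Proof.
move=> dh [z [Kz minz]] [t [x [ty Kx xv]]].
have t0 : \forall k \near \oo, 0 < t k by move/cvgryPgt : ty; apply.
have tV0 : (t k)^-1 @[k --> \oo] --> 0 by apply/gtr0_cvgV0.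
have hh (m : multinom n) : mcoeff m h @[k --> \oo] --> mcoeff m h.
  exact: cvg_cst.
have hx := cvg_peval_leading (fun _ => dh) dh hh tV0 xv.
have : (t k)^-1 ^+ d * peval h z @[k --> \oo] --> 0 ^+ d * peval h z.
  apply: cvgM; last exact: cvg_cst.
  exact: (continuous_cvg _ (@exprn_continuous R _ 0)).
rewrite expr0n eqn0Ngt d_gt0 mul0r => hz.
apply: (ler_cvg_to hz hx); apply: filterS t0 => k tk.
by rewrite ler_wpM2l ?exprn_ge0 ?invr_ge0 ?(ltW tk) ?minz.
Qed.

(** The core of the argument: a limit direction of the x_k spans a ray of
    minimizers of the leading form on the asymptotic cone. *)
Lemma unbounded_minimizers_not_regular (p : nat -> mpoly n R) f
    (x : nat -> 'rV[R]_n) :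
  pdeg f = d -> (forall k, polys_le d (p k)) ->
  (forall m : multinom n, mcoeff m (p k) @[k --> \oo] --> mcoeff m f) ->
  (forall k, Sol K (p k) (x k)) -> `|x k| @[k --> \oo] --> +oo ->
  ~ regular K f.
Proof.
move=> degf dp pf Sx xy.
have df : polys_le d f by rewrite /polys_le /= degf.
have [|phi [v [jphi xv]]] :=
    @bounded_seq_limit_point _ _ (fun k => `|x k|^-1 *: x k) 1.
  move=> k; rewrite normrZ normfV normr_id.
  have [->|xk] := eqVneq `|x k| 0; first by rewrite mulr0.
  by rewrite mulVf.
have phiy := cvg_infty_ge jphi.
have xphiy : `|x (phi j)| @[j --> \oo] --> +oo by exact: cvg_comp phiy xy.
have tV0 : `|x (phi j)|^-1 @[j --> \oo] --> 0.
  by apply/gtr0_cvgV0 => //; move/cvgryPgt : xphiy; apply.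
have Cv : asymptotic_cone K v.
  exists (fun j => `|x (phi j)|), (fun j => x (phi j)); split=> // j.
  by case: (Sx (phi j)).
have f_ge0 w : asymptotic_cone K w -> 0 <= peval (hcomp d f) w.
  move=> Cw; apply: (cvgr_to_ge (cvg_peval_hcomp (v := w) dp df pf)).
  by apply: nearW => k; apply: Sol_hcomp_ge0 => //; exists (x k).
have v1 : `|v| = 1.
  apply: (@cvg_unique _ _ (`| `|x (phi j)|^-1 *: x (phi j) | @[j --> \oo])).
  - exact: norm_hausdorff.
  - exact: cvg_norm.
  - apply: cvg_near_cst; move/cvgryPgt : xphiy => /(_ 0).
    apply: filterS => j xj.
    by rewrite normrZ normfV normr_id mulVf // gt_eqF.
(* The competitor is the fixed point x 0 of K: divided by |x_k|, it tends
   to 0, where the leading form vanishes. *)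
have fv_le0 : peval (hcomp d f) v <= 0.
  have pphif m : mcoeff m (p (phi j)) @[j --> \oo] --> mcoeff m f.
    exact: cvg_comp phiy (pf m).
  have y0 : `|x (phi j)|^-1 *: x 0%N @[j --> \oo] --> (0 : 'rV[R]_n).
    by rewrite -(scale0r (x 0%N)); apply: cvgZ => //; exact: cvg_cst.
  have := cvg_peval_leading (fun j => dp (phi j)) df pphif tV0 y0.
  rewrite -[X in peval _ X](scale0r 0) (peval_hcompZ _ _ df).
  rewrite expr0n eqn0Ngt d_gt0 mul0r => fy.
  have fx := cvg_peval_leading (fun j => dp (phi j)) df pphif tV0 xv.
  apply: (ler_cvg_to fx fy); apply: nearW => j.
  rewrite ler_wpM2l ?exprn_ge0 ?invr_ge0 //.
  by case: (Sx (phi j)) => _; apply; case: (Sx 0%N).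
rewrite /regular degf => -[M [_ boundM]].
(* s v is a minimizer of norm |M| + 2, but |M| + 1 bounds the minimizers. *)
pose s := `|M| + 2.
have s0 : 0 < s by rewrite ltr_wpDl.
have : `|s *: v| <= `|M| + 1.
  apply: boundM; first by rewrite (le_lt_trans (ler_norm _)) // ltrDl.
  split=> [|w Cw]; first exact: asymptotic_cone_scale.
  rewrite (le_trans _ (f_ge0 w Cw)) // (peval_hcompZ _ _ df).
  by rewrite mulr_ge0_le0 // exprn_ge0 // ltW.
by rewrite normrZ v1 mulr1 gtr0_norm // lerD2l leNgt ltr1n.
Qed.

Lemma regular_bounded_minimizers f : pdeg f = d -> regular K f ->
  exists2 e : R, 0 < e &
    bounded_set (\bigcup_(g in poly_ball d 0 e) Sol K (f + g)).
Proof.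
move=> degf reg.
have df : polys_le d f by rewrite /polys_le /= degf.
apply: contrapT => nbd.
have /choice[gx gxP] : forall k : nat, exists gx : mpoly n R * 'rV[R]_n,
    [/\ poly_ball d 0 (k.+1%:R^-1 : R) gx.1, Sol K (f + gx.1) gx.2 &
       k%:R < `|gx.2|].
  move=> k; apply: contrapT => nex; apply: nbd; exists k.+1%:R^-1.
    by rewrite invr_gt0 ltr0n.
  apply: (bounded_set_le (M := k%:R)) => x [g gk Sx].
  by rewrite leNgt; apply/negP => kx; apply: nex; exists (g, x).
apply: (unbounded_minimizers_not_regular (p := fun k => f + (gx k).1)
    (x := fun k => (gx k).2)) reg => // [k|m|k|].
- by apply: polys_leD => //; case: (gxP k) => -[].
- apply: (cvg_mcoeff_coef_norm (e := fun k => k.+1%:R^-1)).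
    exact: cvg_harmonic.
  by move=> k; rewrite addrAC subrr add0r; case: (gxP k) => -[_]; rewrite subr0.
- by case: (gxP k).
- apply/cvgryPge => A; near=> k.
  have [_ _ /ltW] := gxP k; apply: le_trans.
  by near: k; exact: nbhs_infty_ger.
Unshelve. all: by end_near. Qed.

(** Limits of minimizers of polynomials tending to f are minimizers of f, and
    the closed complement of V keeps them out of V. *)
Lemma locally_bounded_Sol_usc f (e : R) : closed K -> polys_le d f -> 0 < e ->
  bounded_set (\bigcup_(g in poly_ball d 0 e) Sol K (f + g)) ->
  upper_semicontinuous_at d (Sol K) f.
Proof.
move=> clK df e0 [M [_ boundM]] V oV SV.
apply: contrapT => nU.
have ek_gt0 (k : nat) : 0 < e / k.+1%:R by rewrite divr_gt0.
have /choice[gx gxP] : forall k : nat, exists gx : mpoly n R * 'rV[R]_n,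
    [/\ poly_ball d f (e / k.+1%:R) gx.1, Sol K gx.1 gx.2 & ~ V gx.2].
  move=> k; apply: contrapT => nex; apply: nU.
  exists (poly_ball d f (e / k.+1%:R)).
    by split; [move=> g []|exists (e / k.+1%:R)].
  by move=> g gk x Sx; apply: contrapT => Vx; apply: nex; exists (g, x).
have [k|phi [v [jphi xv]]] :=
    @bounded_seq_limit_point _ _ (fun k => (gx k).2) (`|M| + 1).
  apply: boundM; first by rewrite (le_lt_trans (ler_norm _)) // ltrDl.
  have [[dg ge] Sg _] := gxP k; exists ((gx k).1 - f);
    last by rewrite addrC subrK.
  split; first exact: polys_leB.
  by rewrite subr0 (lt_le_trans ge) // ler_pdivrMr // ler_peMr ?ler1n // ltW.
have gf m : mcoeff m (gx (phi j)).1 @[j --> \oo] --> mcoeff m f.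
  have ec : e / k.+1%:R @[k --> \oo] --> 0.
    by rewrite -(mulr0 e); apply: cvgM; [exact: cvg_cst|exact: cvg_harmonic].
  have gk k : coef_norm ((gx k).1 - f) < e / k.+1%:R by case: (gxP k) => -[].
  exact: cvg_comp (cvg_infty_ge jphi) (cvg_mcoeff_coef_norm ec gk (m := m)).
have dg j : polys_le d (gx (phi j)).1 by case: (gxP (phi j)) => -[].
have Sv : Sol K f v.
  split=> [|y Ky].
    apply: (closed_cvg _ clK _ _ xv); apply: nearW => j.
    by case: (gxP (phi j)) => _ [].
  have yy : y @[j --> \oo] --> y by exact: cvg_cst.
  apply: (ler_cvg_to (cvg_peval dg df gf xv) (cvg_peval dg df gf yy)).
  by apply: nearW => j; case: (gxP (phi j)) => _ [_ +] _; apply.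
apply: (closed_cvg _ (open_closedC oV) _ _ xv (SV v Sv)).
by apply: nearW => j; case: (gxP (phi j)).
Qed.

End Minimizers.

Theorem proposition4p1 (R : realType) (n d : nat) (K : set 'rV[R]_n)
    (f : mpoly n R) (K_nonempty : K !=set0) (K_closed : closed K)
    (K_convex : convex_set K) (deg_f : pdeg f = d) (d_ge2 : (2 <= d)%N)
    (reg : regular K f) :
  (exists2 e : R, 0 < e &
     bounded_set (\bigcup_(g in poly_ball d 0 e) Sol K (f + g))) /\
  upper_semicontinuous_at d (Sol K) f.
Proof.
have [e e0 bnd] := regular_bounded_minimizers (ltnW d_ge2) deg_f reg.
split; first by exists e.
by apply: (locally_bounded_Sol_usc K_closed _ e0 bnd); rewrite /polys_le /= deg_f.
Qed.
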